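(* Let $G$ be a finite simple connected graph. Then $\chi(G)=\chi_g(G)$ if and only if $G\cong K_2$, where $\chi(G)$ is the chromatic number of $G$ and $\chi_g(G)$ is the graceful chromatic number of $G$.
   Context: For a positive integer $l$, write $[1,l]=\{1,2,\dots,l\}$. A graceful coloring of a simple graph $G$ with $l$ colors, where $l\ge 2$ is an integer, is a proper vertex coloring $g:V(G)\to[1,l]$ (adjacent vertices receive distinct values) such that the induced edge coloring $g^*:E(G)\to[1,l-1]$, $g^*(ab)=|g(a)-g(b)|$ for each edge $ab$, is a proper edge coloring (any two distinct edges sharing an endpoint receive distinct values). The graceful chromatic number $\chi_g(G)$ is the smallest integer $l\ge 2$ for which $G$ has a graceful coloring $g:V(G)\to[1,l]$. $K_2$ is the complete graph on two vertices. *)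

(* Defs.v *)
From mathcomp Require Import all_boot all_order all_algebra.
From mathcomp Require Import zify.

Set Implicit Arguments.
Unset Strict Implicit.
Unset Printing Implicit Defensive.

Record sgraph := SGraph {
  svertex :> finType;
  sedge : rel svertex;
  sedge_sym : symmetric sedge;
  sedge_irrefl : irreflexive sedge }.

(* The graph without vertices is not considered connected. *)
Definition connected_graph (G : sgraph) : Prop :=
  0 < #|G| /\ forall x y : G, connect (@sedge G) x y.

Definition sgraph_iso (G H : sgraph) : Prop :=
  exists2 f : G -> H, bijective f & forall x y, sedge (f x) (f y) = sedge x y.

Lemma neq_sym (T : eqType) : symmetric (fun x y : T => x != y).
Proof. by move=> x y; rewrite eq_sym. Qed.

Lemma neq_irrefl (T : eqType) : irreflexive (fun x y : T => x != y).
Proof. by move=> x; rewrite eqxx. Qed.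

Definition complete_graph (n : nat) : sgraph :=
  SGraph (@neq_sym 'I_n) (@neq_irrefl 'I_n).

Section Coloring.
Variable G : sgraph.
Implicit Types (l : nat) (g : G -> nat).

Definition proper_coloring l g : bool :=
  [forall x, 1 <= g x <= l] && [forall x, forall y, sedge x y ==> (g x != g y)].

(* In the notation `|m - n|, the difference is taken in int. *)
Definition induced_edge_color g (a b : G) : nat := `|g a - g b|%N.

(* An edge coloring is given by a function of the two ends of an edge; two
   distinct edges with common endpoint a are ab and ac with b != c. *)
Definition proper_edge_coloring l (c : G -> G -> nat) : bool :=
  [&& [forall a, forall b, sedge a b ==> (c a b == c b a)],
      [forall a, forall b, sedge a b ==> (1 <= c a b <= l)]
    & [forall a, forall b, forall d,
        [&& sedge a b, sedge a d & b != d] ==> (c a b != c a d)]].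

Definition graceful_coloring l g : bool :=
  proper_coloring l g && proper_edge_coloring l.-1 (induced_edge_color g).

(* Quantifying over finite functions into 'I_l.+1 = {0, ..., l} keeps these
   predicates boolean; the value 0 is excluded by proper_coloring. *)
Definition colorable l : bool :=
  [exists g : {ffun G -> 'I_l.+1}, proper_coloring l (fun x => g x)].

Definition graceful_colorable l : bool :=
  [exists g : {ffun G -> 'I_l.+1}, graceful_coloring l (fun x => g x)].

Lemma colorableP l :
  reflect (exists g : G -> nat, proper_coloring l g) (colorable l).
Proof.
apply: (iffP existsP) => [[g gP]|[g gP]]; first by exists (fun x => g x : nat).
exists [ffun x => inord (g x)].
have E x : [ffun x => inord (g x) : 'I_l.+1] x = g x :> nat.
  case/andP: gP => /forallP /(_ x) /andP[_ le_gl] _.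
  by rewrite ffunE inordK.
apply: etrans gP; rewrite /proper_coloring; congr (_ && _).
  by apply: eq_forallb => x; rewrite E.
by apply: eq_forallb => x; apply: eq_forallb => y; rewrite !E.
Qed.

Lemma graceful_colorableP l :
  reflect (exists g : G -> nat, graceful_coloring l g) (graceful_colorable l).
Proof.
apply: (iffP existsP) => [[g gP]|[g gP]]; first by exists (fun x => g x : nat).
exists [ffun x => inord (g x)].
have E x : [ffun x => inord (g x) : 'I_l.+1] x = g x :> nat.
  case/andP: gP => /andP[/forallP /(_ x) /andP[_ le_gl] _] _.
  by rewrite ffunE inordK.
apply: etrans gP; rewrite /graceful_coloring /proper_coloring.
rewrite /proper_edge_coloring /induced_edge_color.
congr ((_ && _) && [&& _, _ & _]).
- by apply: eq_forallb => x; rewrite E.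
- by apply: eq_forallb => x; apply: eq_forallb => y; rewrite !E.
- by apply: eq_forallb => x; apply: eq_forallb => y; rewrite !E.
- by apply: eq_forallb => x; apply: eq_forallb => y; rewrite !E.
apply: eq_forallb => x; apply: eq_forallb => y; apply: eq_forallb => z.
by rewrite !E.
Qed.

Lemma ex_colorable : exists l, colorable l.
Proof.
exists #|G|; apply/colorableP; exists (fun x => (enum_rank x).+1).
apply/andP; split; first by apply/forallP => x /=; apply: ltn_ord.
apply/forallP => x; apply/forallP => y; apply/implyP => exy.
rewrite eqSS; apply: contraL exy => /eqP/ord_inj/enum_rank_inj ->.
by rewrite sedge_irrefl.
Qed.

Lemma expn2_dist_inj a b c :
  `|2 ^ a - 2 ^ b|%N = `|2 ^ a - 2 ^ c|%N -> b = c.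
Proof.
have pw m n : m < n -> 2 * 2 ^ m <= 2 ^ n.
  by move=> lt_mn; rewrite -expnS leq_exp2l.
have p0 n : 0 < 2 ^ n by rewrite expn_gt0.
have pa := p0 a; have pb := p0 b; have pc := p0 c.
move=> E; suff: 2 ^ b = 2 ^ c by move/eqP; rewrite eqn_exp2l // => /eqP.
case: (ltngtP a b) E => [/pw|/pw|<-]; case: (ltngtP a c) => [/pw|/pw|<-]; lia.
Qed.

Lemma ex_graceful_colorable : exists l, (2 <= l) && graceful_colorable l.
Proof.
exists (2 ^ #|G|.+1).
have G2 : 2 <= 2 ^ #|G|.+1 by rewrite -{1}(expn1 2) leq_exp2l.
apply/andP; split=> //; apply/graceful_colorableP.
pose r (x : G) : nat := enum_rank x.
exists (fun x => 2 ^ r x).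
have r_inj x y : r x = r y -> x = y by move/ord_inj/enum_rank_inj.
have gP x : 0 < 2 ^ r x < 2 ^ #|G|.+1.
  by rewrite expn_gt0 /= ltn_exp2l // ltnW // ltnS ltn_ord.
have neq x y : sedge x y -> 2 ^ r x != 2 ^ r y.
  move=> exy; rewrite eqn_exp2l //; apply: contraL exy => /eqP/r_inj ->.
  by rewrite sedge_irrefl.
apply/andP; split.
  apply/andP; split.
    by apply/forallP => x; have /andP[-> /ltnW] := gP x.
  by apply/forallP => x; apply/forallP => y; apply/implyP => /neq.
rewrite /induced_edge_color; apply/and3P; split.
- by apply/forallP => x; apply/forallP => y; apply/implyP => _; lia.
- apply/forallP => x; apply/forallP => y; apply/implyP => /neq.
  by move: (gP x) (gP y); lia.
apply/forallP => x; apply/forallP => y; apply/forallP => z.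
apply/implyP => /and3P[_ _]; apply: contra => /eqP/expn2_dist_inj/r_inj.
by move/eqP.
Qed.

Definition chromatic_number : nat := ex_minn ex_colorable.

Definition graceful_chromatic_number : nat := ex_minn ex_graceful_colorable.

End Coloring.

(* Main.v *)
Require Import Defs.
From mathcomp Require Import all_boot all_order all_algebra.
From mathcomp Require Import zify.

(** Let [g] be a graceful coloring with [l >= 3] colors.  A vertex of color
    [1 < c < l] has degree at most [l - 2], since its edges receive distinct
    colors and [l - 1] is not among them.  Hence, after renaming the color [l]
    to [2], the coloring of the vertices of colors [1] and [l] extends greedily
    to a proper coloring of the graph with [l - 1] colors, so that
    [chi < chi_g].  A connected graph with a graceful coloring with two colors
    has maximal degree at most [1]: it is [K_1] or [K_2]. *)

(** Vertices outside [S] are recolored one at a time: fewer than [k] neighbors cannot block all [k]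
    colors. *)
Lemma greedy_extension (G : sgraph) k (h : G -> nat) (S : {set G}) :
  (forall x, x \in S -> 1 <= h x <= k) ->
  {in S &, forall x y, sedge x y -> h x != h y} ->
  (forall x, x \notin S -> #|[pred y | sedge x y]| < k) ->
  colorable G k.
Proof.
(* Induction on a bound for the number of uncolored vertices, for all [h] and [S]. *)
move: {2}#|~: S| (leqnn #|~: S|) => n.
elim: n h S => [|n IHn] h S.
  rewrite leqn0 cards_eq0 => /eqP S0 hb hp _.
  have inS x : x \in S by have := in_set0 x; rewrite -S0 inE => /negbFE.
  apply/colorableP; exists h; apply/andP; split.
    by apply/forallP => x; apply: hb.
  by apply/forallP => x; apply/forallP => y; apply/implyP; apply: hp.
move=> Sn hb hp hd.
have [S0|[v]] := set_0Vmem (~: S).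
  by apply: (IHn h S) => //; rewrite S0 cards0.
rewrite inE => vS.
(* Pigeonhole. The placeholder values of [h] at uncolored neighbors are avoided too, which is
   harmless as the degree bound counts all neighbors. *)
have /hasP[c c_k c_free] :
    has [pred c | c \notin [seq h w | w in [pred y | sedge v y]]] (iota 1 k).
  apply/negPn/negP => /hasPn all_used.
  have sub : {subset iota 1 k <= [seq h w | w in [pred y | sedge v y]]}.
    by move=> c /all_used /= /negPn.
  have := uniq_leq_size (iota_uniq 1 k) sub.
  by rewrite size_iota size_image leqNgt hd.
have free w : sedge v w -> c != h w.
  move=> evw; apply: contraNneq c_free => ->.
  by apply: image_f; rewrite inE.
apply: (IHn (fun x => if x == v then c else h x) (v |: S)).
- by rewrite -(leq_add2l #|v |: S|) cardsC -(cardsC S) cardsU1 vS; lia.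
- move=> x; rewrite !inE; case: eqP => [_ _|_ /hb //].
  by move: c_k; rewrite mem_iota add1n ltnS.
- move=> x y; rewrite !inE; case: eqP => [->|_]; case: eqP => [->|_] //=.
  + by rewrite sedge_irrefl.
  + by move=> _ _; apply: free.
  + by move=> _ _; rewrite sedge_sym eq_sym; apply: free.
  exact: hp.
by move=> x; rewrite !inE negb_or => /andP[_]; apply: hd.
Qed.

Lemma graceful_coloringP (G : sgraph) l (g : G -> nat) :
  reflect [/\ forall x, 1 <= g x <= l,
              forall x y, sedge x y -> g x != g y
            & forall a b d, sedge a b -> sedge a d ->
                `|g a - g b|%N = `|g a - g d|%N -> b = d]
          (graceful_coloring l g).
Proof.
apply: (iffP idP).
  case/andP=> /andP[/forallP gb /forallP gp] /and3P[_ _ /forallP ge].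
  split=> // [x y exy | a b d eab ead eg].
    by move/forallP: (gp x) => /(_ y); rewrite exy.
  move/forallP: (ge a) => /(_ b)/forallP/(_ d).
  rewrite eab ead /= /induced_edge_color eg eqxx.
  by case: (b =P d).
case=> gb gp ge; rewrite /graceful_coloring /proper_coloring.
rewrite /proper_edge_coloring /induced_edge_color -andbA.
apply/and5P; split.
- by apply/forallP => x; apply: gb.
- by apply/forallP => x; apply/forallP => y; apply/implyP; apply: gp.
- by apply/forallP => x; apply/forallP => y; apply/implyP => _; lia.
- apply/forallP => x; apply/forallP => y; apply/implyP => /gp.
  by move: (gb x) (gb y); lia.
apply/forallP => a; apply/forallP => b; apply/forallP => d.
apply/implyP => /and3P[eab ead]; apply: contra => /eqP eg.
by apply/eqP; apply: ge eg.
Qed.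

Lemma degree_inner_color (G : sgraph) l (g : G -> nat) v :
  graceful_coloring l g -> 1 < g v < l -> #|[pred y | sedge v y]| <= l - 2.
Proof.
move=> /graceful_coloringP[gb gp ge] gv.
rewrite cardE -(size_map (fun y => `|g v - g y|%N)) -(size_iota 1 (l - 2)).
apply: uniq_leq_size.
  rewrite map_inj_in_uniq ?enum_uniq // => x y.
  by rewrite !mem_enum !inE; apply: ge.
(* A difference of [l - 1] occurs only between the colors [1] and [l], so the edge colors at [v] lie
   in [[1, l - 2]]. *)
move=> c /mapP[y]; rewrite mem_enum inE => /gp + ->; rewrite mem_iota.
by move: (gb y); lia.
Qed.

Lemma graceful_colorable_pred (G : sgraph) l :
  2 < l -> graceful_colorable G l -> colorable G l.-1.
Proof.
move=> l3 /graceful_colorableP[g gl].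
have /graceful_coloringP[gb gp _] := gl.
(* Adjacent vertices of [S] have colors [1] and [l], which become [1] and [2]; color [2] is
   available since [2 < l]. Outside [S] the value [2] is a placeholder. *)
apply: (@greedy_extension G l.-1 (fun x => if g x == 1 then 1 else 2)
          [set x | (g x == 1) || (g x == l)]).
- by move=> x _; case: eqP; lia.
- move=> x y; rewrite !inE => Sx Sy /gp.
  by case: (g x =P 1) Sx; case: (g y =P 1) Sy => /=; lia.
move=> x; rewrite inE => Sx.
have gx : 1 < g x < l by move: (gb x); lia.
by have := degree_inner_color _ _ _ _ gl gx; lia.
Qed.

Lemma edgeless_colorable1 (G : sgraph) :
  (forall x y : G, ~~ sedge x y) -> colorable G 1.
Proof.
move=> noe; apply/colorableP; exists (fun=> 1); apply/andP; split.
  exact/forallP.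
by apply/forallP => x; apply/forallP => y; rewrite (negbTE (noe x y)).
Qed.

Lemma colorable_edge_gt1 (G : sgraph) (x y : G) l :
  sedge x y -> colorable G l -> 1 < l.
Proof.
move=> exy /colorableP[g /andP[/forallP gb /forallP/(_ x)/forallP/(_ y)]].
by rewrite exy; move: (gb x) (gb y) => /=; lia.
Qed.

Lemma graceful2_iso_K2 (G : sgraph) (x y : G) :
  connected_graph G -> graceful_colorable G 2 -> sedge x y ->
  sgraph_iso G (complete_graph 2).
Proof.
move=> [_ conn] /graceful_colorableP[g /graceful_coloringP[gb gp ge]] exy.
have eyx : sedge y x by rewrite sedge_sym.
(* With two vertex colors every edge has color [1], so no two edges share an endpoint. *)
have nb (a b d : G) : sedge a b -> sedge a d -> b = d.
  move=> eab ead; apply: (ge a) => //.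
  by move: (gp _ _ eab) (gp _ _ ead) (gb a) (gb b) (gb d); lia.
(* The ends of the edge form a set closed under adjacency, which is all of [G] by connectedness. *)
have cl : closed (@sedge G) (pred2 x y).
  apply: intro_closed; first exact/sym_connect_sym/sedge_sym.
  move=> a b eab; rewrite !inE => /orP[] /eqP E; rewrite {}E in eab.
    by rewrite (nb _ _ _ eab exy) eqxx orbT.
  by rewrite (nb _ _ _ eab eyx) eqxx.
have xyP z : (z == x) || (z == y).
  by have := closed_connect cl (conn x z); rewrite !inE eqxx /= => <-.
have nyx : y != x by apply: contraL exy => /eqP ->; rewrite sedge_irrefl.
pose o0 : 'I_2 := ord0; pose o1 : 'I_2 := ord_max.
exists (fun z => if z == x then o0 else o1 : complete_graph 2).
  exists (fun i : 'I_2 => if i == o0 then x else y) => [z|i].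
    by have /orP[] := xyP z => /eqP ->; rewrite ?eqxx ?(negbTE nyx).
  by case: (i =P o0) => [->|]; rewrite ?eqxx // (negbTE nyx) => ni;
     apply/val_inj; case: i ni => [[|[|i]] //] Hi ni; case: ni; apply/val_inj.
move=> a b; have /orP[] := xyP a => /eqP ->; have /orP[] := xyP b => /eqP ->;
  by rewrite ?eqxx ?(negbTE nyx) ?sedge_irrefl ?exy ?eyx.
Qed.

Lemma iso_K2_graceful2 (G : sgraph) :
  sgraph_iso G (complete_graph 2) -> graceful_colorable G 2.
Proof.
case=> f /bij_inj f_inj fe; apply/graceful_colorableP.
exists (fun x => (f x : 'I_2).+1); apply/graceful_coloringP; split.
- by move=> x; apply: (ltn_ord (f x : 'I_2)).
- by move=> x y; rewrite -fe.
move=> a b d; rewrite -!fe /= -!val_eqE /= => eab ead _.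
(* ['I_2] has only one element other than [f a], so [f b] and [f d] agree. *)
apply/f_inj/val_inj => /=.
by move: eab ead (ltn_ord (f a : 'I_2)) (ltn_ord (f b : 'I_2))
  (ltn_ord (f d : 'I_2)); lia.
Qed.

Theorem theorem3p1 (G : sgraph) (hG : connected_graph G) :
  chromatic_number G = graceful_chromatic_number G <->
  sgraph_iso G (complete_graph 2).
Proof.
rewrite /chromatic_number /graceful_chromatic_number.
case: ex_minnP => k kcol kmin; case: ex_minnP => l /andP[l2 lcol] lmin.
split=> [E | iso].
  rewrite {k}E in kcol kmin.
  have El : l = 2.
    case: (ltnP 2 l) => [l3|]; last by lia.
    (* A coloring with [l - 1] colors would contradict the minimality of [l] as chromatic number. *)
    by have := kmin _ (graceful_colorable_pred _ _ l3 lcol); lia.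
  rewrite {l l2}El in lcol kmin kcol lmin.
  case: (pickP [pred p : G * G | sedge p.1 p.2]) => [[x y] /= exy|noe].
    exact: graceful2_iso_K2 exy.
  (* Without edges one color suffices, while the chromatic number is [2] here; this excludes the
     one-vertex graph. *)
  have /edgeless_colorable1/kmin // : forall x y : G, ~~ sedge x y.
  by move=> x y; have /= -> := noe (x, y).
have gr2 := iso_K2_graceful2 _ iso.
have le_l2 : l <= 2 by apply: lmin.
have le_k2 : k <= 2.
  by apply: kmin; have /graceful_colorableP[g /andP[gP _]] := gr2;
     apply/colorableP; exists g.
(* The edge of [K_2], pulled back to [G], forces at least two colors, so both numbers are [2]. *)
have [f [h _ hK] fe] := iso.
have exy : sedge (h ord0) (h ord_max) by rewrite -fe !hK.
by have := colorable_edge_gt1 _ _ _ _ exy kcol; lia.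
Qed.
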